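(* Let $A\subset\omega^\omega$. Then: (i) Player I has a winning strategy in the game $\tilde G(A)$ if and only if $A$ contains a nonempty superperfect subset $P$. (ii) Player II has a winning strategy in the game $\tilde G(A)$ if and only if $A$ is $\sigma$-bounded.
   Context: $\omega^\omega$ is the Baire space. For $f,g\in\omega^\omega$, $f\leq g$ means $f(n)\leq g(n)$ for all $n$. A set $A\subset\omega^\omega$ is $\sigma$-bounded if there is a sequence $(f_i)_{i<\omega}$ in $\omega^\omega$ such that for every $f\in A$ there is $i<\omega$ with $f\leq f_i$. A tree on $\omega$ is a set $T$ of finite sequences of natural numbers closed under initial segments; $[T]$ is the set of $f\in\omega^\omega$ all of whose finite initial segments lie in $T$. A tree $T$ is superperfect if every $u\in T$ has an extension $v\in T$ (possibly $v=u$) such that $\{m<\omega : v\cdot(m)\in T\}$ is infinite, where the dot denotes concatenation of sequences. A set $P\subset\omega^\omega$ is superperfect if $P=[T]$ for some superperfect tree $T$. The game $\tilde G(A)$: Players I and II alternate with perfect information; I plays $s_0$, II plays $n_1$, I plays $s_1$, II plays $n_2$, I plays $s_2$, and so on, where each $s_i$ is a nonempty finite sequence of natural numbers and each $n_i\in\omega$. Player I wins if (1) $s_0\cdot s_1\cdot s_2\cdots\in A$ and (2) $s_i(0)>n_i$ for all $i\geq1$, where $s_i(0)$ is the first entry of $s_i$. Otherwise Player II wins. Strategies and winning strategies are understood in the usual sense. *)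

(* Defs.v *)
From mathcomp Require Import all_boot all_order.
From mathcomp Require Import boolp classical_sets functions cardinality.

Set Implicit Arguments.
Unset Strict Implicit.
Unset Printing Implicit Defensive.

Local Open Scope classical_set_scope.

Definition baire : Type := nat -> nat.

(* [<=%O] on functions is the pointwise order, see [boolp.lefP]. *)
Definition sigma_bounded (A : set baire) : Prop :=
  exists F : nat -> baire,
    forall f : baire, A f -> exists i : nat, ((f : nat -> nat) <= F i)%O.

Definition is_tree (T : set (seq nat)) : Prop :=
  forall u v : seq nat, prefix u v -> T v -> T u.

Definition body (T : set (seq nat)) : set baire :=
  [set f | forall n : nat, T (mkseq f n)].

Definition superperfect_tree (T : set (seq nat)) : Prop :=
  is_tree T /\
  forall u : seq nat, T u ->
    exists v : seq nat,
      [/\ T v, prefix u v & infinite_set [set m : nat | T (rcons v m)]].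

Definition superperfect (P : set baire) : Prop :=
  exists T : set (seq nat), superperfect_tree T /\ P = body T.

(* The moves of player I. *)
Definition neseq : Type := {s : seq nat | s != [::]}.

(* The infinite concatenation s_0 s_1 s_2 ...: as every s_i is nonempty,
   s_0 ... s_n has length at least n + 1, so the default value of [nth] is
   never used. *)
Definition concat (s : nat -> neseq) : baire :=
  fun n => nth 0 (flatten (mkseq (fun i => val (s i)) n.+1)) n.

(* A play s_0, n_1, s_1, n_2, s_2, ... is given by [s i] = s_i and
   [t i] = n_(i+1): [t i] is the answer of player II to [s i], and [s i.+1] is
   the next move of player I. *)
Definition I_wins (A : set baire) (s : nat -> neseq) (t : nat -> nat) : Prop :=
  A (concat s) /\ forall i : nat, t i < head 0 (val (s i.+1)).

(* The first k rounds (s_0, n_1), ..., (s_(k-1), n_k) of a play. *)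
Definition rounds (s : nat -> neseq) (t : nat -> nat) (k : nat) :
    seq (neseq * nat) :=
  mkseq (fun i => (s i, t i)) k.

(* Strategies are total functions on positions; player II also sees the move
   of player I that opens the current round. *)
Definition strategyI : Type := seq (neseq * nat) -> neseq.
Definition strategyII : Type := seq (neseq * nat) -> neseq -> nat.

Definition winningI (A : set baire) (sigma : strategyI) : Prop :=
  forall (s : nat -> neseq) (t : nat -> nat),
    (forall k : nat, s k = sigma (rounds s t k)) -> I_wins A s t.

Definition winningII (A : set baire) (tau : strategyII) : Prop :=
  forall (s : nat -> neseq) (t : nat -> nat),
    (forall k : nat, t k = tau (rounds s t k) (s k)) -> ~ I_wins A s t.

(* Main.v *)
Require Import Defs.
From mathcomp Require Import all_boot all_order.
From mathcomp Require Import boolp classical_sets functions cardinality.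

(** (i) Given a winning strategy of I, the prefixes of the words that I can have
    played form a tree.  After any such word I may be asked to exceed any number,
    so every node extends to an infinitely splitting one
    ([strategy_tree_superperfect]).  A branch f of this tree is the outcome of a
    single play, and hence lies in A ([body_strategy_tree]): if the word built so
    far has length l and is a prefix of f, the next answer n of II has to be
    smaller than the first entry f(l) of the reply of I, so only finitely many
    answers are compatible with f, and Koenig's lemma ([strategy_tree_step])
    yields an infinite play.  Conversely, in a superperfect tree I walks from one
    infinitely splitting node to the next, leaving each of them through a number
    above the last answer of II ([superperfect_winningI]).

    (ii) If A is bounded by F_0, F_1, ..., then in round k player II answers the
    value of F_k at the length of the word played so far; a winning I would
    produce an element of A lying below no F_k ([sigma_bounded_winningII]).
    Conversely, let tau win for II and f be in A.  If, from every position whose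
    word is a prefix of f, player I could continue along f while exceeding the
    answer of tau, I would beat tau with outcome f.  So there is a stuck position
    p: past the word of p, each value of f is at most the answer of tau to the
    piece of f read since then ([winningII_stuck]).  The functions stuck at p with
    a given first value after the word of p are branches of one finitely
    branching tree, so one function bounds them all
    ([finitely_branching_bounded]); and there are countably many pairs of a
    position and a value ([winningII_sigma_bounded]). *)

Local Open Scope classical_set_scope.

(** * Words and plays *)

Lemma take_mkseq (T : Type) (g : nat -> T) (m n : nat) :
  m <= n -> take m (mkseq g n) = mkseq g m.
Proof. by move=> le_mn; rewrite /mkseq -map_take take_iota (minn_idPl le_mn). Qed.

Lemma prefix_mkseq (T : eqType) (g : nat -> T) (m n : nat) :
  m <= n -> prefix (mkseq g m) (mkseq g n).
Proof. by move=> le_mn; rewrite -(take_mkseq _ g _ _ le_mn) prefix_take. Qed.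

Definition word (s : nat -> neseq) (k : nat) : seq nat :=
  flatten (mkseq (fun i => val (s i)) k).

Definition pos_word (p : seq (neseq * nat)) : seq nat :=
  flatten [seq val r.1 | r <- p].

Lemma prefix_mkseqE (f : baire) (n : nat) (u : seq nat) :
  prefix (mkseq f n) u -> forall i, i < n -> nth 0 u i = f i.
Proof.
move=> /prefixP[v ->] i lt_in.
by rewrite nth_cat size_mkseq lt_in nth_mkseq.
Qed.

Lemma wordS (s : nat -> neseq) (k : nat) :
  word s k.+1 = word s k ++ val (s k).
Proof. by rewrite /word mkseqS flatten_rcons. Qed.

Lemma pos_word_rcons (p : seq (neseq * nat)) (s : neseq) (n : nat) :
  pos_word (rcons p (s, n)) = pos_word p ++ val s.
Proof. by rewrite /pos_word map_rcons flatten_rcons. Qed.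

Lemma pos_word_rounds (s : nat -> neseq) (t : nat -> nat) (k : nat) :
  pos_word (rounds s t k) = word s k.
Proof. by rewrite /pos_word /word /rounds /mkseq -map_comp. Qed.

Lemma neseq_gt0 (s : neseq) : 0 < size (val s).
Proof. by case: s => -[]. Qed.

Lemma size_word (s : nat -> neseq) (k : nat) : k <= size (word s k).
Proof.
elim: k => // k IHk; rewrite wordS size_cat -addn1.
by rewrite leq_add // neseq_gt0.
Qed.

Lemma word_prefix (s : nat -> neseq) (j k : nat) :
  j <= k -> prefix (word s j) (word s k).
Proof.
move=> /subnK <-; elim: (k - j) => [|d IHd]; first exact: prefix_refl.
by rewrite addSn wordS; apply: prefix_trans IHd (prefix_prefix _ _).
Qed.

Lemma nth_word (s : nat -> neseq) (i k : nat) :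
  i < size (word s k) -> nth 0 (word s k) i = concat s i.
Proof.
have nth_prefix (u v : seq nat) j :
    prefix u v -> j < size u -> nth 0 v j = nth 0 u j.
  by move=> /prefixP[w ->] lt_ju; rewrite nth_cat lt_ju.
move=> lt_ik; rewrite /concat -/(word s i.+1).
have [le|/ltnW le] := leqP k i.+1.
  by rewrite (nth_prefix _ _ _ (word_prefix s _ _ le)).
by rewrite (nth_prefix _ _ _ (word_prefix s _ _ le)) // size_word.
Qed.

Lemma mkseq_concat (s : nat -> neseq) (k : nat) :
  mkseq (concat s) (size (word s k)) = word s k.
Proof.
apply: (@eq_from_nth _ 0); rewrite size_mkseq // => i lt_i.
by rewrite nth_mkseq // nth_word.
Qed.

(** As the words of a play grow without bound, they determine its outcome. *)
Lemma concat_unique (s : nat -> neseq) (f : baire) :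
  (forall k, mkseq f (size (word s k)) = word s k) -> concat s = f.
Proof.
move=> fE; apply: funext => n.
have lt_n := size_word s n.+1.
by rewrite -(nth_word s n n.+1) // -fE nth_mkseq.
Qed.

Lemma concat_size_word (s : nat -> neseq) (k : nat) :
  concat s (size (word s k)) = head 0 (val (s k)).
Proof.
have lt_k : size (word s k) < size (word s k.+1).
  by rewrite wordS size_cat -[ltnLHS]addn0 ltn_add2l neseq_gt0.
by rewrite -(nth_word _ _ _ lt_k) wordS nth_cat ltnn subnn nth0.
Qed.

(** Besides opposing two given strategies, this produces plays against a sequence
    of answers fixed beforehand, seen as a strategy that looks only at the
    position, and plays in which the moves of I are chosen along a given
    function. *)
Lemma play_of_strategies (sigma : strategyI) (tau : strategyII) :
  exists (s : nat -> neseq) (t : nat -> nat),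
    (forall k, s k = sigma (rounds s t k)) /\
    (forall k, t k = tau (rounds s t k) (s k)).
Proof.
pose round p := (sigma p, tau p (sigma p)).
pose p k := iter k (fun q => rcons q (round q)) [::].
pose s k := (round (p k)).1; pose t k := (round (p k)).2.
have roundsE k : rounds s t k = p k.
  by elim: k => // k IHk; rewrite /rounds mkseqS -/(rounds s t k) IHk.
by exists s, t; split=> k; rewrite roundsE.
Qed.

(** * Winning strategies of player I and superperfect sets *)

Lemma infinite_natP (X : set nat) :
  infinite_set X <-> forall n, exists2 m, n < m & X m.
Proof.
split=> [Xinf n|Xunb /finite_seqP[r rE]].
  apply: contrapT => bounded; apply: Xinf.
  apply: (sub_finite_set _ (finite_II n.+1)) => m Xm /=.
  by rewrite ltnNge; apply/negP => lt_nm; apply: bounded; exists m.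
have [m lt_m] := Xunb (\max_(i <- r) i).
rewrite rE /= => mr; move: lt_m.
by rewrite (big_rem _ mr) /= ltnNge leq_maxl.
Qed.

(** Against a fixed strategy of I, a position is determined by the answers of II;
    coding positions by answers leaves only consistent ones to speak about. *)
Definition answer_pos (sigma : strategyI) (ns : seq nat) : seq (neseq * nat) :=
  foldl (fun p n => rcons p (sigma p, n)) [::] ns.

(** This includes the reply of I to the last answer. *)
Definition answer_word (sigma : strategyI) (ns : seq nat) : seq nat :=
  pos_word (answer_pos sigma ns) ++ val (sigma (answer_pos sigma ns)).

Definition strategy_tree (sigma : strategyI) : set (seq nat) :=
  [set u | exists ns, prefix u (answer_word sigma ns)].

Lemma answer_pos_rcons sigma ns n :
  answer_pos sigma (rcons ns n) =
  rcons (answer_pos sigma ns) (sigma (answer_pos sigma ns), n).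
Proof. by rewrite /answer_pos foldl_rcons. Qed.

Lemma answer_word_rcons sigma ns n :
  answer_word sigma (rcons ns n) =
  answer_word sigma ns ++ val (sigma (answer_pos sigma (rcons ns n))).
Proof. by rewrite {1}/answer_word {1}answer_pos_rcons pos_word_rcons. Qed.

Lemma answer_word_prefix sigma ns q :
  prefix (answer_word sigma ns) (answer_word sigma (ns ++ q)).
Proof.
elim/last_ind: q => [|q n IHq]; first by rewrite cats0 prefix_refl.
by rewrite -rcons_cat answer_word_rcons; apply: prefix_trans IHq (prefix_prefix _ _).
Qed.

Lemma rounds_answer_pos (sigma : strategyI) (s : nat -> neseq) (t : nat -> nat) :
  (forall k, s k = sigma (rounds s t k)) ->
  forall k, rounds s t k = answer_pos sigma (mkseq t k).
Proof.
move=> sE; elim=> // k IHk.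
by rewrite /rounds !mkseqS -/(rounds s t k) answer_pos_rcons -IHk sE.
Qed.

(** [winningI] speaks of infinite plays; this transfers its second winning
    condition to finite positions, by completing them to a play. *)
Lemma winningI_head (A : set baire) (sigma : strategyI) :
  winningI A sigma ->
  forall ns n, n < head 0 (val (sigma (answer_pos sigma (rcons ns n)))).
Proof.
move=> win ns n.
(* II plays the prescribed answers, then 0 forever. *)
pose tau : strategyII := fun p _ => nth 0 (rcons ns n) (size p).
have [s [t [sE tE]]] := play_of_strategies sigma tau.
have tnth k : t k = nth 0 (rcons ns n) k by rewrite tE /tau size_mkseq.
have [_ /(_ (size ns))] := win s t sE.
rewrite tnth nth_rcons ltnn eqxx sE (rounds_answer_pos _ _ _ sE).
suff -> : mkseq t (size ns).+1 = rcons ns n by [].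
rewrite -(size_rcons ns n) -[RHS](mkseq_nth 0).
by apply: eq_mkseq.
Qed.

(** A full word of I splits infinitely because the reply to each answer n starts
    above n. *)
Lemma strategy_tree_superperfect (A : set baire) (sigma : strategyI) :
  winningI A sigma -> superperfect_tree (strategy_tree sigma).
Proof.
move=> win; split=> [u v uv [ns vns]|u [ns uns]].
  by exists ns; apply: prefix_trans uv vns.
exists (answer_word sigma ns); split=> //; first by exists ns; exact: prefix_refl.
apply/infinite_natP => n.
set s := sigma (answer_pos sigma (rcons ns n)).
exists (head 0 (val s)); first exact: winningI_head win ns n.
exists (rcons ns n); rewrite answer_word_rcons -/s.
have := neseq_gt0 s; case: (val s) => //= a r _.
by rewrite -cat_rcons prefix_prefix.
Qed.

(** The step of Koenig's lemma: if arbitrarily long prefixes of f are met by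
    continuing ns, this remains so after a suitable next answer n.  Otherwise
    each n fails from some length M n on; but for a prefix of f that reaches
    beyond the word of ns, only the answers n < f(l) are possible, where l is the
    length of that word, and a prefix longer than all their M n is out of
    reach. *)
Lemma strategy_tree_step (A : set baire) (sigma : strategyI) (f : baire) (ns : seq nat) :
  winningI A sigma ->
  (forall m, exists q, prefix (mkseq f m) (answer_word sigma (ns ++ q))) ->
  exists n, forall m,
    exists q, prefix (mkseq f m) (answer_word sigma (rcons ns n ++ q)).
Proof.
move=> win live; apply: contrapT => dead.
have {dead} /choice[M ME] : forall n, exists m, forall q,
    ~ prefix (mkseq f m) (answer_word sigma (rcons ns n ++ q)).
  move=> n; apply: contrapT => nM; apply: dead; exists n => m.
  by apply: contrapT => nq; apply: nM; exists m => q qP; apply: nq; exists q.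
set l := size (answer_word sigma ns).
pose m := l.+1 + \max_(n < f l) M n.
(* The word of ns itself, obtained for q empty, is shorter than m. *)
have [[|n q] qP] := live m.
  have := size_prefix qP.
  by rewrite cats0 size_mkseq -/l /m addSn ltnNge leq_addr.
rewrite -cat_rcons in qP.
have lt_n : n < f l.
  have lt_lm : l < m by rewrite /m addSn ltnS leq_addr.
  rewrite -(prefix_mkseqE _ _ _ qP l lt_lm).
  have /prefixP[w ->] := answer_word_prefix sigma (rcons ns n) q.
  rewrite answer_word_rcons -catA nth_cat ltnn subnn.
  have := winningI_head A sigma win ns n.
  by have := neseq_gt0 (sigma (answer_pos sigma (rcons ns n))); case: (val _).
apply: (ME n q); apply: prefix_trans qP.
have le_Mm : M n <= m.
  apply: leq_trans (leq_addl _ _).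
  by rewrite (bigD1 (Ordinal lt_n)) //= leq_maxl.
exact: prefix_mkseq.
Qed.

Lemma body_strategy_tree (A : set baire) (sigma : strategyI) :
  winningI A sigma -> body (strategy_tree sigma) `<=` A.
Proof.
move=> win f fT.
pose live ns :=
  forall m, exists q, prefix (mkseq f m) (answer_word sigma (ns ++ q)).
have /choice[next nextP] : forall ns, exists n, live ns -> live (rcons ns n).
  move=> ns; have [nsP|nsN] := pselect (live ns); last by exists 0.
  by have [n nP] := strategy_tree_step A sigma f ns win nsP; exists n.
have [s [t [sE tE]]] := play_of_strategies sigma (fun p _ => next (unzip2 p)).
have {}tE k : t k = next (mkseq t k).
  by rewrite tE /unzip2 /rounds /mkseq -map_comp.
have liveP k : live (mkseq t k).
  by elim: k => [|k IHk]; [exact: fT|rewrite mkseqS tE; exact: nextP].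
suff <- : concat s = f by have [] := win s t sE.
apply: concat_unique => k.
have [q] := liveP k (size (word s k)).
have /prefixP[w ->] := answer_word_prefix sigma (mkseq t k) q.
rewrite /answer_word -(rounds_answer_pos _ _ _ sE) pos_word_rounds -!catA.
by rewrite prefixE size_mkseq take_size_cat // => /eqP.
Qed.

(** Player I keeps the invariant that the word played is an infinitely splitting
    node of T. *)
Lemma superperfect_winningI (A : set baire) (T : set (seq nat)) :
  superperfect_tree T -> T [::] -> body T `<=` A ->
  exists sigma, winningI A sigma.
Proof.
move=> [Ttree Tsplit] T0 TA.
pose splits v := T v /\ infinite_set [set m | T (rcons v m)].
have /choice[ext extP] : forall un : seq nat * nat, exists s : neseq,
    splits un.1 -> splits (un.1 ++ val s) /\ un.2 < head 0 (val s).
  move=> [u n] /=; have [uP|uN] := pselect (splits u); last first.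
    by exists (exist _ [:: 0] isT).
  have [_ /infinite_natP/(_ n)[m lt_nm Tum]] := uP.
  have [v [Tv /prefixP[w vE] vinf]] := Tsplit _ Tum.
  by exists (exist _ (m :: w) isT) => _ /=; rewrite -cat_rcons -vE.
have [v0 [Tv0 _ v0inf]] := Tsplit _ T0.
(* The first splitting node v0 may be empty, which is not a legal first move. *)
have [s0 s0P] : exists s0 : neseq, splits (val s0).
  have [vS _] := extP (v0, 0) (conj Tv0 v0inf).
  have vn0 : v0 ++ val (ext (v0, 0)) != [::].
    by rewrite -size_eq0 size_cat -lt0n addn_gt0 neseq_gt0 orbT.
  by exists (exist (fun s => s != [::]) _ vn0).
pose sigma : strategyI := fun p =>
  if p is [::] then s0 else ext (pos_word p, last 0 (unzip2 p)).
exists sigma => s t sE.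
have sS k : s k.+1 = ext (word s k.+1, t k).
  rewrite sE -(pos_word_rounds s t) /sigma; congr (ext (_, _)).
  by rewrite /rounds mkseqS /unzip2 map_rcons last_rcons.
have word_splits k : splits (word s k.+1).
  elim: k => [|k IHk]; first by rewrite wordS sE.
  by rewrite wordS sS; have [] := extP (_, t k) IHk.
split; last by move=> k; rewrite sS; have [] := extP (_, t k) (word_splits k).
apply: TA => n; apply: (Ttree _ (word s n.+1)); last by have [] := word_splits n.
by rewrite -(mkseq_concat s n.+1) prefix_mkseq // ltnW // size_word.
Qed.

(** * Winning strategies of player II and sigma-boundedness *)

(** The next entry, of index l, of the outcome has to exceed F_k(l), so the outcome
    is not below F_k; every k gets its round. *)
Lemma sigma_bounded_winningII (A : set baire) :
  sigma_bounded A -> exists tau, winningII A tau.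
Proof.
move=> [F FP].
exists (fun p s => F (size p) (size (pos_word p ++ val s))) => s t tE [As head_gt].
have [k /lefP/(_ (size (word s k.+1)))] := FP _ As.
have := head_gt k; rewrite tE size_mkseq pos_word_rounds -wordS concat_size_word.
by move=> /leq_trans/[apply]; rewrite ltnn.
Qed.

(** The sequences all of whose entries obey the bound G form a finitely branching
    tree; at each level take the maximum of G over its finitely many nodes. *)
Lemma finitely_branching_bounded (G : seq nat -> nat) :
  exists h : baire, forall f : baire,
    (forall j, f j <= G (mkseq f j)) -> forall j, f j <= h j.
Proof.
pose level j := iter j
  (fun B => flatten [seq [seq rcons v m | m <- iota 0 (G v).+1] | v <- B]) [:: [::]].
exists (fun j => \max_(v <- level j) G v) => f fG j.
suff fB i : mkseq f i \in level i.
  by apply: leq_trans (fG j) _; rewrite (big_rem _ (fB j)) leq_maxl.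
elim: i => [|i IHi]; first by rewrite inE.
rewrite mkseqS; apply/flatten_mapP; exists (mkseq f i) => //.
by apply: map_f; rewrite mem_iota add0n ltnS fG.
Qed.

(** If no position along f were stuck, choosing at each one a piece of f that
    beats tau would define a strategy of I, whose play against tau has outcome f
    and is won by I. *)
Lemma winningII_stuck (A : set baire) (tau : strategyII) (f : baire) :
  winningII A tau -> A f ->
  exists p, mkseq f (size (pos_word p)) = pos_word p /\
    forall s : neseq, let w := pos_word p ++ val s in
      mkseq f (size w) = w -> f (size w) <= tau p s.
Proof.
move=> win Af; apply: contrapT => stuck.
have /choice[sigma sigmaP] : forall p, exists s : neseq,
    mkseq f (size (pos_word p)) = pos_word p ->
    let w := pos_word p ++ val s in
    mkseq f (size w) = w /\ tau p s < f (size w).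
  move=> p; apply: contrapT => nos; apply: stuck; exists p; split.
    apply: contrapT => nfp; apply: nos.
    by exists (exist _ [:: 0] isT) => /nfp.
  move=> s w fw; rewrite leqNgt; apply/negP => lt_f.
  by apply: nos; exists s.
have [s [t [sE tE]]] := play_of_strategies sigma tau.
have fs k : mkseq f (size (word s k)) = word s k.
  elim: k => // k IHk; rewrite wordS -(pos_word_rounds s t) sE.
  by have [] := sigmaP (rounds s t k); rewrite pos_word_rounds.
have fE : concat s = f by exact: concat_unique.
apply: (win s t tE); split; first by rewrite fE.
move=> k; rewrite -concat_size_word fE tE wordS -(pos_word_rounds s t) sE.
by have [] := sigmaP (rounds s t k); rewrite pos_word_rounds.
Qed.

Lemma winningII_sigma_bounded (A : set baire) (tau : strategyII) :
  winningII A tau -> sigma_bounded A.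
Proof.
move=> win.
(* For c = (p, m), G c bounds the first entries by the word of p followed by m,
   and each later one by the answer of tau to the piece read since the word of p.
   That piece is nonempty then, so the default [:: 0] is never reached. *)
pose G (c : seq (neseq * nat) * nat) v :=
  if size v <= size (pos_word c.1) then nth 0 (rcons (pos_word c.1) c.2) (size v)
  else tau c.1 (insubd (exist _ [:: 0] isT) (drop (size (pos_word c.1)) v)).
have /choice[h hP] := fun c => finitely_branching_bounded (G c).
exists (fun i => if unpickle i is Some c then h c else fun=> 0) => f Af.
have [p [fp fle]] := winningII_stuck A tau f win Af.
set l := size (pos_word p) in fp.
exists (pickle (p, f l)); rewrite pickleK; apply/lefP; apply: hP => j.
rewrite /G /= size_mkseq -/l; case: (leqP j l) => [le_jl|lt_lj].
  have -> : rcons (pos_word p) (f l) = mkseq f l.+1 by rewrite mkseqS fp.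
  by rewrite nth_mkseq.
set s := insubd _ _.
have sE : val s = drop l (mkseq f j).
  by rewrite val_insubd -size_eq0 size_drop size_mkseq subn_eq0 -ltnNge lt_lj.
have wE : pos_word p ++ val s = mkseq f j.
  by rewrite sE -fp -(take_mkseq _ f _ _ (ltnW lt_lj)) cat_take_drop.
by have := fle s; cbv zeta; rewrite wE size_mkseq; apply.
Qed.

Theorem theorem4p5p3 (A : set baire) :
  ((exists sigma : strategyI, winningI A sigma) <->
   (exists P : set baire, [/\ superperfect P, P !=set0 & P `<=` A])) /\
  ((exists tau : strategyII, winningII A tau) <-> sigma_bounded A).
Proof.
split; split.
- move=> [sigma win]; exists (body (strategy_tree sigma)); split.
  + by exists (strategy_tree sigma); split=> //; exact: strategy_tree_superperfect win.
  + have [s [t [sE _]]] := play_of_strategies sigma (fun _ _ => 0).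
    exists (concat s) => n; exists (mkseq t n).
    rewrite /answer_word -(rounds_answer_pos _ _ _ sE) pos_word_rounds -sE -wordS.
    by rewrite -(mkseq_concat s n.+1) prefix_mkseq // ltnW // size_word.
  + exact: body_strategy_tree.
- move=> [_ [[T [Tsp ->]] [f fT] TA]].
  exact: superperfect_winningI Tsp (fT 0) TA.
- by move=> [tau win]; exact: winningII_sigma_bounded win.
- exact: sigma_bounded_winningII.
Qed.
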